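(* Let $a<b$ be integers, $\mathbf{I}=[a,b]\cap\mathbb{Z}$ and $\mathbf{I}^*=[a,b]\cap(\mathbb{Z}+\tfrac12)$, and consider the box $\mathbf{I}\times\{0,1\}$. Let $f:\mathbf{I}^*_0\to\mathbb{C}$ be a complex-valued function and let $\beta>0$. Then there is a unique massive s-holomorphic (with parameter $\beta$) extension $h$ of $f$ to $\mathbf{I}^*_0\cup\mathbf{I}_{1/2}\cup\mathbf{I}^*_1$ with Riemann boundary values on $\partial\mathbf{I}_{1/2}$.
   Context: Edges of the square lattice are identified with their midpoints in $\mathbb{C}$. $\mathbf{I}^*_y=\{k+iy:k\in\mathbf{I}^*\}$ (horizontal edges), $\mathbf{I}_{1/2}=\{x+\frac i2:x\in\mathbf{I}\}$ (vertical edges), $\partial\mathbf{I}_{1/2}=\{a+\frac i2,b+\frac i2\}$. Set $\lambda=e^{i\pi/4}$ and $\nu=\lambda^{-3}\frac{e^{-2\beta}+i}{e^{-2\beta}-i}$. A function $F$ on the edges is massive s-holomorphic (parameter $\beta$) if for each face, with center $c$ and edges $E=c+\frac12$, $N=c+\frac i2$, $W=c-\frac12$, $S=c-\frac i2$ (here the faces are $c=k+\frac i2$, $k\in\mathbf{I}^*$), $F(N)+\nu^{-1}\lambda\overline{F(N)}=\nu^{-1}F(E)+\lambda\overline{F(E)}$, $F(N)+\nu\lambda^{-1}\overline{F(N)}=\nu F(W)+\lambda^{-1}\overline{F(W)}$, $F(S)+\nu\lambda^{3}\overline{F(S)}=\nu F(E)+\lambda^{3}\overline{F(E)}$, $F(S)+\nu^{-1}\lambda^{-3}\overline{F(S)}=\nu^{-1}F(W)+\lambda^{-3}\overline{F(W)}$.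 Riemann boundary values at a boundary edge $z$: $h(z)$ is a real multiple of $\tau_{cw}(z)^{-1/2}$, where $\tau_{cw}(z)$ is the clockwise unit tangent of the box at $z$. Here $\tau_{cw}=i$ on the left side and $-i$ on the right side, so the condition is $h(a+\frac i2)\in\mathbb{R}\lambda^{-1}$ and $h(b+\frac i2)\in\mathbb{R}\lambda$. *)

(* Defs.v *)
From HB Require Import structures.
From mathcomp Require Import all_boot all_order all_algebra.
From mathcomp Require Import complex.
From mathcomp Require Import all_classical all_reals all_analysis.
From mathcomp Require Import ring lra.

Set Implicit Arguments.
Unset Strict Implicit.
Unset Printing Implicit Defensive.

Import Order.TTheory GRing.Theory Num.Theory.

Local Open Scope classical_set_scope.
Local Open Scope ring_scope.
Local Open Scope complex_scope.

Definition int_interval (R : realType) (a b : int) : set R :=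
  [set x | x \is a Num.int /\ a%:~R <= x <= b%:~R].
Arguments int_interval : clear implicits.

Definition half_int_interval (R : realType) (a b : int) : set R :=
  [set k | k - 2^-1 \is a Num.int /\ a%:~R <= k <= b%:~R].
Arguments half_int_interval : clear implicits.

(* Edges of the square lattice are identified with their midpoints in R[i];
   [x +i* y] is the point of abscissa x and ordinate y. *)

Definition horizontal_edges (R : realType) (a b : int) (y : R) : set R[i] :=
  [set k +i* y | k in half_int_interval R a b].
Arguments horizontal_edges : clear implicits.

Definition vertical_edges (R : realType) (a b : int) : set R[i] :=
  [set x +i* 2^-1 | x in int_interval R a b].
Arguments vertical_edges : clear implicits.

Definition boundary_vertical_edges (R : realType) (a b : int) : set R[i] :=
  [set a%:~R +i* 2^-1; b%:~R +i* 2^-1].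
Arguments boundary_vertical_edges : clear implicits.

Definition box_edges (R : realType) (a b : int) : set R[i] :=
  horizontal_edges R a b 0 `|` vertical_edges R a b `|` horizontal_edges R a b 1.
Arguments box_edges : clear implicits.

Definition box_faces (R : realType) (a b : int) : set R[i] :=
  [set k +i* 2^-1 | k in half_int_interval R a b].
Arguments box_faces : clear implicits.

(* lambda = exp (i pi / 4) *)
Definition lambda (R : realType) : R[i] := cos (pi / 4) +i* sin (pi / 4).

Definition nu (R : realType) (beta : R) : R[i] :=
  lambda R ^- 3 * (((expR (- 2 * beta))%:C + 'i%C) / ((expR (- 2 * beta))%:C - 'i%C)).

(* The four relations between the values on the east, north, west and south
   edges of a face. *)
Definition massive_s_holomorphic_relations (R : realType) (beta : R)
    (FE FN FW FS : R[i]) : Prop :=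
  let l := lambda R in let n := nu beta in
  [/\ FN + n^-1 * l * FN^*%C = n^-1 * FE + l * FE^*%C,
      FN + n * l^-1 * FN^*%C = n * FW + l^-1 * FW^*%C,
      FS + n * l ^+ 3 * FS^*%C = n * FE + l ^+ 3 * FE^*%C &
      FS + n^-1 * l ^- 3 * FS^*%C = n^-1 * FW + l ^- 3 * FW^*%C].

(* The hypotheses identify E, N, W, S as the edges of the face centred at c;
   they can always be met in the box, by [box_faceP] below. *)
Definition massive_s_holomorphic (R : realType) (beta : R) (a b : int)
    (F : box_edges R a b -> R[i]) : Prop :=
  forall (c : R[i]) (E N W S : box_edges R a b), box_faces R a b c ->
    \val E = c + 2^-1 -> \val N = c + 'i%C / 2 ->
    \val W = c - 2^-1 -> \val S = c - 'i%C / 2 ->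
    massive_s_holomorphic_relations beta (F E) (F N) (F W) (F S).

Definition extends (R : realType) (A B : set R[i])
    (f : A -> R[i]) (h : B -> R[i]) : Prop :=
  forall (z : A) (w : B), \val w = \val z -> h w = f z.

(* Clockwise unit tangent of the box at a boundary vertical edge z: upwards on
   the left side (abscissa a), downwards on the right side. *)
Definition tau_cw (R : realType) (a : int) (z : R[i]) : R[i] :=
  if complex.Re z == a%:~R then 'i%C else - 'i%C.

(* v is a real multiple of t ^ (-1/2); the choice of the square root, s or - s,
   is immaterial. *)
Definition real_multiple_inv_sqrt (R : realType) (t v : R[i]) : Prop :=
  exists s : R[i], s ^+ 2 = t^-1 /\ exists r : R, v = r%:C * s.

Definition riemann_boundary_values (R : realType) (a b : int)
    (h : box_edges R a b -> R[i]) : Prop :=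
  forall z : box_edges R a b, boundary_vertical_edges R a b (\val z) ->
    real_multiple_inv_sqrt (tau_cw a (\val z)) (h z).

Lemma box_faceP (R : realType) (a b : int) (c : R[i]) : box_faces R a b c ->
  [/\ box_edges R a b (c + 2^-1), box_edges R a b (c + 'i%C / 2),
      box_edges R a b (c - 2^-1) & box_edges R a b (c - 'i%C / 2)].
Proof.
have half : (2^-1 : R[i]) = 2^-1 +i* 0.
  by rewrite -(rmorph_nat (real_complex R) 2) -fmorphV.
move=> [k [/intrP[m km] /andP[ak kb]] <-].
have kE : k = m%:~R + 2^-1 by rewrite -km; ring.
have am : (a <= m)%R.
  rewrite -ltzD1 -(ltr_int R) intrD; move: ak; rewrite kE; lra.
have mb : (m + 1 <= b)%R.
  rewrite lezD1 -(ltr_int R); move: kb; rewrite kE; lra.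
move: am mb; rewrite -!(ler_int R) intrD => am mb.
have ihalf : ('i%C / 2 : R[i]) = 0 +i* 2^-1.
  by rewrite half; simpc.
have hk : half_int_interval R a b k.
  by split; [apply/intrP; exists m | apply/andP].
rewrite ihalf half; split.
- left; right; exists (m + 1)%:~R; last first.
    by rewrite kE intrD; apply/eqP; rewrite eq_complex /=; apply/andP; split;
       apply/eqP; field.
  by split; [exact: intr_int | rewrite intrD; apply/andP; split; lra].
- right; exists k => //.
  by apply/eqP; rewrite eq_complex /=; apply/andP; split; apply/eqP; field.
- left; right; exists m%:~R; last first.
    by rewrite kE; apply/eqP; rewrite eq_complex /=; apply/andP; split;
       apply/eqP; field.
  by split; [exact: intr_int | apply/andP; split; lra].
- left; left; exists k => //.
  by apply/eqP; rewrite eq_complex /=; apply/andP; split; apply/eqP; field.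
Qed.

Lemma lambda_sqr (R : realType) : lambda R ^+ 2 = 'i%C.
Proof.
have H : (pi / 2 : R) = pi / 4 + pi / 4 by field.
have := cosD (pi / 4 : R) (pi / 4); rewrite -H cos_pihalf => hc.
have := sinD (pi / 4 : R) (pi / 4); rewrite -H sin_pihalf => hs.
rewrite /lambda expr2; apply/eqP; rewrite eq_complex /= -hc eqxx /=.
by apply/eqP; apply: (etrans _ (esym hs)); rewrite addrC.
Qed.

Lemma real_multiple_inv_sqrtP (R : realType) (t u v : R[i]) : u ^+ 2 = t^-1 ->
  real_multiple_inv_sqrt t v <-> exists r : R, v = r%:C * u.
Proof.
move=> ut; split; last by move=> [r ->]; exists u; split => //; exists r.
move=> [s [st [r ->]]]; have : s ^+ 2 == u ^+ 2 by rewrite st ut.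
rewrite eqf_sqr => /orP[] /eqP ->; first by exists r.
by exists (- r); rewrite rmorphN mulNr mulrN.
Qed.

Lemma real_multiple_left (R : realType) (a : int) (v : R[i]) :
  real_multiple_inv_sqrt (tau_cw a (a%:~R +i* 2^-1)) v <->
  exists r : R, v = r%:C * (lambda R)^-1.
Proof.
by apply: real_multiple_inv_sqrtP; rewrite /tau_cw eqxx exprVn lambda_sqr.
Qed.

Lemma real_multiple_right (R : realType) (a b : int) (v : R[i]) : (a < b)%R ->
  real_multiple_inv_sqrt (tau_cw a (b%:~R +i* 2^-1)) v <->
  exists r : R, v = r%:C * lambda R.
Proof.
move=> ab; apply: real_multiple_inv_sqrtP.
rewrite /tau_cw /= eqr_int gt_eqF // lambda_sqr.
have i2 : ('i%C : R[i]) * 'i%C = -1 by exact: (sqr_i R).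
have i0 : ('i%C : R[i]) != 0 by rewrite eq_complex /= oner_eq0 andbF.
by apply: (mulIf i0); rewrite invrN mulNr mulVf.
Qed.

(* Main.v *)
Require Import Defs.
From mathcomp Require Import all_boot all_order all_algebra.
From mathcomp Require Import complex.
From mathcomp Require Import all_classical all_reals all_analysis.
From mathcomp Require Import ring lra.

(* Every relation of the form p w + q w^* = s with |p| = |q| = 1 is a single real
   equation on w, and two of them with independent linear parts determine w by
   Cramer's rule. The two relations of a face involving F(S) give one such equation
   on F(E) and one on F(W), so each vertical edge carries exactly two equations: one
   from the face on its left, or the boundary condition on the left side, and one
   from the face on its right, or the boundary condition on the right side. The
   vertical values are thus determined locally by f, and the remaining two relations
   of each face then determine F(N). Independence amounts to g != 1, g^2 != 1 and
   g^2 != -1 for g = nu lambda^3; only the last one uses beta != 0. *)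

Import Order.TTheory GRing.Theory Num.Theory.

Local Open Scope classical_set_scope.
Local Open Scope ring_scope.
Local Open Scope complex_scope.

(** * Real equations on a complex unknown and Cramer's rule *)

(* The triple (p, q, s) stands for the equation p w + q w^* = s; under
   [consistent] it is a single real equation on w. *)
Definition sat {R : realType} (e : R[i] * R[i] * R[i]) (w : R[i]) : Prop :=
  e.1.1 * w + e.1.2 * w^*%C = e.2.

Definition unimodular {R : realType} (p : R[i]) : Prop := p * p^*%C = 1.

(** For unimodular [p] and [q], the expression [p w + q w^*] is always fixed by the antilinear
    involution [z -> p q z^*]. The last condition puts [s] on the same real line of fixed points. *)
Definition consistent {R : realType} (e : R[i] * R[i] * R[i]) : Prop :=
  [/\ unimodular e.1.1, unimodular e.1.2 & e.1.1 * e.1.2 * e.2^*%C = e.2].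

Definition minor {R : realType} (e1 e2 : R[i] * R[i] * R[i]) : R[i] :=
  e1.1.1 * e2.1.2 - e2.1.1 * e1.1.2.

(** First unknown of the 2 by 2 system in which [w] and [w^*] are treated as independent
    unknowns. *)
Definition cramer {R : realType} (e1 e2 : R[i] * R[i] * R[i]) : R[i] :=
  (e1.2 * e2.1.2 - e2.2 * e1.1.2) / minor e1 e2.

Lemma sat_cramer_eq {R : realType} (e1 e2 : R[i] * R[i] * R[i]) (w : R[i]) :
  minor e1 e2 != 0 -> sat e1 w -> sat e2 w -> w = cramer e1 e2.
Proof.
rewrite /cramer => D0 <- <-; apply: (canRL (mulfK D0)).
by rewrite /minor; ring.
Qed.

Lemma conjD {R : realType} (x y : R[i]) : (x + y)^*%C = x^*%C + y^*%C.
Proof. exact: (rmorphD (@conjc R)). Qed.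

Lemma conjB {R : realType} (x y : R[i]) : (x - y)^*%C = x^*%C - y^*%C.
Proof. exact: (rmorphB (@conjc R)). Qed.

Lemma conjN {R : realType} (x : R[i]) : (- x)^*%C = - x^*%C.
Proof. exact: (rmorphN (@conjc R)). Qed.

Lemma conjM {R : realType} (x y : R[i]) : (x * y)^*%C = x^*%C * y^*%C.
Proof. exact: (rmorphM (@conjc R)). Qed.

Lemma conjV {R : realType} (x : R[i]) : (x^-1)^*%C = x^*%C^-1.
Proof. exact: (fmorphV (@conjc R)). Qed.

Lemma conj0 {R : realType} : (0 : R[i])^*%C = 0.
Proof. exact: (rmorph0 (@conjc R)). Qed.

Lemma conjX {R : realType} (x : R[i]) k : (x ^+ k)^*%C = x^*%C ^+ k.
Proof. exact: (rmorphXn (@conjc R)). Qed.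

Lemma unimodular_neq0 {R : realType} (p : R[i]) : unimodular p -> p != 0.
Proof.
move=> pp; apply/eqP => p0; move: pp; rewrite /unimodular p0 mul0r => /eqP.
by rewrite eq_sym oner_eq0.
Qed.

Lemma conj_unimodular {R : realType} (p : R[i]) : unimodular p -> p^*%C = p^-1.
Proof.
by move=> pp; apply: (mulfI (unimodular_neq0 p pp)); rewrite pp mulfV // unimodular_neq0.
Qed.

(** The left side is the conjugate of the [cramer] quotient after substituting [p^* = p^-1],
    [q^* = q^-1] and [s^* = s / (p q)]. The right side is Cramer's value of the second unknown. *)
Lemma cramer_conj {F : fieldType} (p1 q1 s1 p2 q2 s2 : F) :
  p1 != 0 -> q1 != 0 -> p2 != 0 -> q2 != 0 -> p1 * q2 - p2 * q1 != 0 ->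
  (s1 / (p1 * q1) * q2^-1 - s2 / (p2 * q2) * q1^-1) /
    (p1^-1 * q2^-1 - p2^-1 * q1^-1) =
  (p1 * s2 - p2 * s1) / (p1 * q2 - p2 * q1).
Proof.
move=> p10 q10 p20 q20 D0.
have -> : p1^-1 * q2^-1 - p2^-1 * q1^-1 =
          - (p1 * q2 - p2 * q1) / (p1 * q1 * p2 * q2).
  by field; rewrite ?p10 ?q10 ?p20 ?q20.
by field; rewrite oppr_eq0 D0 q20 p20 q10 p10.
Qed.

(** Cramer's pair solves the system in two independent unknowns; consistency makes its second
    component the conjugate of the first, which turns it into a solution of the original
    equations. *)
Lemma sat_cramer {R : realType} (e1 e2 : R[i] * R[i] * R[i]) :
  consistent e1 -> consistent e2 -> minor e1 e2 != 0 ->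
  sat e1 (cramer e1 e2) /\ sat e2 (cramer e1 e2).
Proof.
case: e1 e2 => [[p1 q1] s1] [[p2 q2] s2]; rewrite /sat /cramer /minor /=.
move=> [/= pp1 qq1 ss1] [/= pp2 qq2 ss2] D0.
have p10 := unimodular_neq0 _ pp1; have q10 := unimodular_neq0 _ qq1.
have p20 := unimodular_neq0 _ pp2; have q20 := unimodular_neq0 _ qq2.
have s1E : s1^*%C = s1 / (p1 * q1) by rewrite -[in RHS]ss1 mulrC mulKf // mulf_neq0.
have s2E : s2^*%C = s2 / (p2 * q2) by rewrite -[in RHS]ss2 mulrC mulKf // mulf_neq0.
have -> : ((s1 * q2 - s2 * q1) / (p1 * q2 - p2 * q1))^*%C =
          (p1 * s2 - p2 * s1) / (p1 * q2 - p2 * q1).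
  rewrite conjM conjV !conjB !conjM s1E s2E (conj_unimodular p1) // (conj_unimodular q1) //.
  rewrite (conj_unimodular p2) // (conj_unimodular q2) //.
  exact: cramer_conj.
split; apply: (mulIf D0); rewrite mulrDl -!mulrA mulVf // ?mulr1; ring.
Qed.

(** * The phase [lambda], the mass factor and the determinants *)

Lemma lambda_unimodular {R : realType} : unimodular (lambda R).
Proof.
apply/eqP; rewrite /lambda eq_complex /=; apply/andP; split; apply/eqP; last by ring.
by rewrite mulrN opprK -!expr2 cos2Dsin2.
Qed.

Lemma lambda_pow4 {R : realType} : lambda R ^+ 4 = -1.
Proof. by rewrite (exprM _ 2 2) lambda_sqr; exact: sqr_i. Qed.

(** This is the number [g = nu lambda^3]. *)
Definition mass_ratio {R : realType} (beta : R) : R[i] :=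
  ((expR (- 2 * beta))%:C + 'i%C) / ((expR (- 2 * beta))%:C - 'i%C).

Lemma subC_i_neq0 {R : realType} (e : R) : 0 < e -> e%:C - 'i%C != 0 :> R[i].
Proof. by move=> e0; rewrite eq_complex /= negb_and subr0 gt_eqF. Qed.

Lemma mass_ratio_unimodular {R : realType} (beta : R) :
  unimodular (mass_ratio beta).
Proof.
rewrite /unimodular /mass_ratio; have := expR_gt0 (- 2 * beta).
move: (expR _) => e e0; have en := subC_i_neq0 _ e0.
have ep : e%:C + 'i%C != 0 :> R[i] by rewrite eq_complex /= negb_and addr0 gt_eqF.
have ec : (e%:C)^*%C = e%:C by apply/eqP; rewrite eq_complex /= oppr0 !eqxx.
have ic : ('i%C : R[i])^*%C = - 'i%C by apply/eqP; rewrite eq_complex /= oppr0 !eqxx.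
rewrite conjM conjV conjB conjD ec ic opprK mulf_div [X in _ / X]mulrC.
by rewrite mulfV // mulf_neq0.
Qed.

Lemma mass_ratio_neq1 {R : realType} (beta : R) : mass_ratio beta != 1.
Proof.
rewrite /mass_ratio; have := expR_gt0 (- 2 * beta); move: (expR _) => e e0.
apply/eqP => /(canRL (mulfVK (subC_i_neq0 _ e0))).
by rewrite mul1r => /eqP; rewrite eq_complex /= => /andP[_ /eqP]; lra.
Qed.

Lemma mass_ratio_neqN1 {R : realType} (beta : R) : mass_ratio beta != -1.
Proof.
rewrite /mass_ratio; have := expR_gt0 (- 2 * beta); move: (expR _) => e e0.
apply/eqP => /(canRL (mulfVK (subC_i_neq0 _ e0))).
by rewrite mulN1r => /eqP; rewrite eq_complex /= => /andP[/eqP]; lra.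
Qed.

(** Equality would mean [g = i] or [g = -i]. With [e = exp (-2 beta)], comparing real parts then
    gives [e = 1] or [e = -1], whereas [0 < e < 1]. *)
Lemma mass_ratio_sqr_neqN1 {R : realType} (beta : R) :
  0 < beta -> mass_ratio beta ^+ 2 != -1.
Proof.
move=> beta0; have : expR (- 2 * beta) < 1 by rewrite expR_lt1; lra.
rewrite /mass_ratio; have := expR_gt0 (- 2 * beta); move: (expR _) => e e0 e1.
have -> : -1 = 'i%C ^+ 2 :> R[i] by rewrite sqr_i.
rewrite eqf_sqr negb_or; apply/andP; split; apply/eqP;
  move=> /(canRL (mulfVK (subC_i_neq0 _ e0))) /eqP;
  by rewrite eq_complex /= => /andP[/eqP + _]; lra.
Qed.

(** These are the determinants of the pairs left/west, left/right, east/west, east/right and of the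
    two north equations. Since [l^4 = -1], they equal [g - 1], [2], [g^2 + 1], [g - 1] and [g^2 - 1]
    up to sign and powers of [l] and [g]. *)
Lemma minors_neq0 {F : fieldType} (l g : F) : let n := l ^- 3 * g in
  l ^+ 4 = -1 -> 2 != 0 :> F -> g != 0 -> g != 1 -> g != -1 -> g ^+ 2 != -1 ->
  [/\ l * l ^- 3 - n^-1 * - l^-1 != 0,
      l * - l - l^-1 * - l^-1 != 0,
      n * l ^- 3 - n^-1 * l ^+ 3 != 0,
      n * - l - l^-1 * l ^+ 3 != 0 &
      1 * (n * l^-1) - 1 * (n^-1 * l) != 0].
Proof.
move=> n l4 two0 g0 g1 gN1 g2.
have l0 : l != 0.
  apply/eqP => l0; move: l4; rewrite l0 expr0n /= => /eqP.
  by rewrite eq_sym oppr_eq0 oner_eq0.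
have l8 : l ^+ 8 = 1 by rewrite (exprM _ 4 2) l4 sqrrN expr1n.
have l12 : l ^+ 12 = -1 by rewrite (exprD _ 8 4) l4 l8 mul1r.
rewrite /n; split.
- rewrite (_ : _ - _ = l ^- 2 * g^-1 * (g + l ^+ 4)); last by field; rewrite l0 g0.
  by rewrite l4 !mulf_neq0 ?invr_eq0 ?expf_neq0 // subr_eq0.
- rewrite (_ : _ - _ = l ^- 2 * (1 - l ^+ 4)); last by field.
  by rewrite l4 opprK mulf_neq0 // invr_eq0 expf_neq0.
- rewrite (_ : _ - _ = l ^- 6 * g^-1 * (g ^+ 2 - l ^+ 12)); last by field; rewrite l0 g0.
  by rewrite l12 !mulf_neq0 ?invr_eq0 ?expf_neq0 // subr_eq0.
- rewrite (_ : _ - _ = - (l ^- 2 * (g + l ^+ 4))); last by field.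
  by rewrite l4 oppr_eq0 mulf_neq0 ?invr_eq0 ?expf_neq0 // subr_eq0.
- rewrite (_ : _ - _ = l ^- 4 * g^-1 * (g ^+ 2 - l ^+ 8)); last by field; rewrite l0 g0.
  rewrite l8 !mulf_neq0 ?invr_eq0 ?expf_neq0 // subr_eq0 sqrf_eq1 negb_or.
  by rewrite g1 gN1.
Qed.

(** * Face relations and boundary conditions as real equations *)

(** The relations of a face are sorted by unknown. [east_eq] and [west_eq] take [F(S)] as data and
    constrain [F(E)] and [F(W)]; the two north equations take [F(E)] or [F(W)] as data and constrain
    [F(N)]. *)
Definition east_eq {R : realType} (beta : R) (s : R[i]) : R[i] * R[i] * R[i] :=
  (nu beta, lambda R ^+ 3, s + nu beta * lambda R ^+ 3 * s^*%C).

Definition west_eq {R : realType} (beta : R) (s : R[i]) : R[i] * R[i] * R[i] :=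
  ((nu beta)^-1, lambda R ^- 3, s + (nu beta)^-1 * lambda R ^- 3 * s^*%C).

Definition north_eq_east {R : realType} (beta : R) (e : R[i]) : R[i] * R[i] * R[i] :=
  (1, (nu beta)^-1 * lambda R, (nu beta)^-1 * e + lambda R * e^*%C).

Definition north_eq_west {R : realType} (beta : R) (w : R[i]) : R[i] * R[i] * R[i] :=
  (1, nu beta * (lambda R)^-1, nu beta * w + (lambda R)^-1 * w^*%C).

(** A value [v] is a real multiple of [lambda^-1] exactly when [lambda v] equals its own conjugate
    [lambda^-1 v^*]. *)
Definition left_eq (R : realType) : R[i] * R[i] * R[i] :=
  (lambda R, - (lambda R)^-1, 0).

Definition right_eq (R : realType) : R[i] * R[i] * R[i] :=
  ((lambda R)^-1, - lambda R, 0).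

Lemma massive_relationsP {R : realType} (beta : R) (FE FN FW FS : R[i]) :
  massive_s_holomorphic_relations beta FE FN FW FS <->
  [/\ sat (north_eq_east beta FE) FN, sat (north_eq_west beta FW) FN,
      sat (east_eq beta FS) FE & sat (west_eq beta FS) FW].
Proof.
rewrite /massive_s_holomorphic_relations /sat /=.
by rewrite !mul1r; split=> -[-> -> -> ->].
Qed.

Lemma unimodularM {R : realType} (p q : R[i]) :
  unimodular p -> unimodular q -> unimodular (p * q).
Proof. by move=> pp qq; rewrite /unimodular conjM mulrACA pp qq mulr1. Qed.

Lemma unimodularV {R : realType} (p : R[i]) : unimodular p -> unimodular p^-1.
Proof. by move=> pp; rewrite /unimodular conjV -invfM pp invr1. Qed.

Lemma unimodularX {R : realType} (p : R[i]) k : unimodular p -> unimodular (p ^+ k).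
Proof. by move=> pp; rewrite /unimodular conjX -exprMn pp expr1n. Qed.

Lemma unimodularN {R : realType} (p : R[i]) : unimodular p -> unimodular (- p).
Proof. by move=> pp; rewrite /unimodular conjN mulrNN. Qed.

Lemma unimodular1 {R : realType} : unimodular (1 : R[i]).
Proof. by rewrite /unimodular mul1r; exact: (rmorph1 (@conjc R)). Qed.

Lemma nu_unimodular {R : realType} (beta : R) : unimodular (nu beta).
Proof.
apply: unimodularM; last exact: mass_ratio_unimodular.
exact/unimodularV/unimodularX/lambda_unimodular.
Qed.

(** The right-hand side [u z + v z^*] is fixed by [t -> u v t^*], and [p q = u v] makes this the
    involution attached to the left-hand side. All four face relations have this shape. *)
Lemma consistent_line {R : realType} (p q u v z : R[i]) :
  unimodular p -> unimodular q -> unimodular u -> unimodular v ->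
  p * q = u * v -> consistent (p, q, u * z + v * z^*%C).
Proof.
move=> pp qq uu vv pquv; split=> //=.
rewrite pquv conjD !conjM conjcK mulrDr mulrACA uu mul1r.
by rewrite (mulrC u) mulrACA vv mul1r addrC.
Qed.

#[local] Hint Resolve lambda_unimodular nu_unimodular
 unimodular1 unimodularM unimodularV unimodularX unimodularN : core.

Lemma east_eq_consistent {R : realType} (beta : R) s : consistent (east_eq beta s).
Proof.
by rewrite /east_eq -[X in X + _]mul1r;
  apply: consistent_line; auto; rewrite mul1r.
Qed.

Lemma west_eq_consistent {R : realType} (beta : R) s : consistent (west_eq beta s).
Proof.
by rewrite /west_eq -[X in X + _]mul1r;
  apply: consistent_line; auto; rewrite mul1r.
Qed.

Lemma north_eq_east_consistent {R : realType} (beta : R) e :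
  consistent (north_eq_east beta e).
Proof. by 
  apply: consistent_line; auto; rewrite mul1r.
Qed.

Lemma north_eq_west_consistent {R : realType} (beta : R) w :
  consistent (north_eq_west beta w).
Proof. by 
  apply: consistent_line; auto; rewrite mul1r.
Qed.

Lemma consistent_homogeneous {R : realType} (p q : R[i]) :
  unimodular p -> unimodular q -> consistent (p, q, 0).
Proof.
move=> pp qq; have := consistent_line p q p q 0 pp qq pp qq erefl.
by rewrite conj0 !mulr0 addr0.
Qed.

Lemma left_eq_consistent {R : realType} : consistent (left_eq R).
Proof. by apply: consistent_homogeneous; auto. Qed.

Lemma right_eq_consistent {R : realType} : consistent (right_eq R).
Proof. by apply: consistent_homogeneous; auto. Qed.

Lemma box_minors_neq0 {R : realType} (beta : R) (s t : R[i]) : 0 < beta ->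
  [/\ minor (left_eq R) (west_eq beta t) != 0,
      minor (left_eq R) (right_eq R) != 0,
      minor (east_eq beta s) (west_eq beta t) != 0,
      minor (east_eq beta s) (right_eq R) != 0 &
      minor (north_eq_east beta s) (north_eq_west beta t) != 0].
Proof.
move=> beta0; apply: (minors_neq0 (lambda R) (mass_ratio beta)).
- exact: lambda_pow4.
- by rewrite pnatr_eq0.
- exact/unimodular_neq0/mass_ratio_unimodular.
- exact: mass_ratio_neq1.
- exact: mass_ratio_neqN1.
- exact: mass_ratio_sqr_neqN1.
Qed.

Lemma sat_real_line {R : realType} (p v : R[i]) : unimodular p ->
  sat (p, - p^-1, 0) v <-> exists r : R, v = r%:C * p^-1.
Proof.
move=> pp; have p0 := unimodular_neq0 _ pp.
have conj_pv : (p * v)^*%C = p^-1 * v^*%C by rewrite conjM conj_unimodular.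
rewrite /sat /= mulNr -conj_pv; split=> [/eqP|[r ->]].
  (* The equation says that [p v] is its own conjugate, so the real factor is its real part. *)
  rewrite subr_eq0 => /eqP pv; exists (complex.Re (p * v)).
  apply: (canRL (mulfK p0)); rewrite mulrC.
  move: pv; case: (p * v) => x y /eqP; rewrite eq_complex /= => /andP[_ /eqP yN].
  by apply/eqP; rewrite eq_complex /= eqxx /=; apply/eqP; lra.
rewrite mulrC mulfVK //; apply/eqP; rewrite subr_eq0.
by rewrite eq_complex /= oppr0 !eqxx.
Qed.

Lemma sat_left_eq {R : realType} (v : R[i]) :
  sat (left_eq R) v <-> exists r : R, v = r%:C * (lambda R)^-1.
Proof. exact/sat_real_line/lambda_unimodular. Qed.

Lemma sat_right_eq {R : realType} (v : R[i]) :
  sat (right_eq R) v <-> exists r : R, v = r%:C * lambda R.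
Proof.
have := @sat_real_line R (lambda R)^-1 v; rewrite /right_eq invrK.
by apply; exact/unimodularV/lambda_unimodular.
Qed.

(** * The explicit solution *)

Definition edge {T : Type} {A : set T} {z : T} (Az : A z) : A :=
  @exist _ (fun z => z \in A) z (mem_set Az).

(** Extending [f] by 0 to every abscissa lets the formulas below avoid membership proofs. The
    default is never read when they are evaluated at an edge of the box. *)
Definition bottom_value {R : realType} {a b : int}
    (f : horizontal_edges R a b 0 -> R[i]) (k : R) : R[i] :=
  if pselect (horizontal_edges R a b 0 (k +i* 0)) is left kab
  then f (edge kab) else 0.

Lemma bottom_valueE {R : realType} {a b : int}
    (f : horizontal_edges R a b 0 -> R[i]) (z : horizontal_edges R a b 0) (k : R) :
  \val z = k +i* 0 -> bottom_value f k = f z.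
Proof.
move=> zk; rewrite /bottom_value; case: pselect => [kab|[]].
  by congr f; apply: val_inj.
by rewrite -zk; exact: set_valP.
Qed.

(** The face on the left of the edge at [x] has its south edge at [x - 1/2] and sees the edge as its
    east one, hence [east_eq]. *)
Definition vertical_eq_left {R : realType} (beta : R) (a : int) (f0 : R -> R[i]) (x : R) :=
  if x == a%:~R then left_eq R else east_eq beta (f0 (x - 2^-1)).

Definition vertical_eq_right {R : realType} (beta : R) (b : int) (f0 : R -> R[i]) (x : R) :=
  if x == b%:~R then right_eq R else west_eq beta (f0 (x + 2^-1)).

Definition vertical_value {R : realType} (beta : R) (a b : int) (f0 : R -> R[i]) (x : R) :=
  cramer (vertical_eq_left beta a f0 x) (vertical_eq_right beta b f0 x).

Definition top_value {R : realType} (beta : R) (v : R -> R[i]) (k : R) :=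
  cramer (north_eq_east beta (v (k + 2^-1))) (north_eq_west beta (v (k - 2^-1))).

(** On the box the ordinate is 0, 1/2 or 1, so the last branch is the top row. *)
Definition box_value {R : realType} (beta : R) {a b : int}
    (f : horizontal_edges R a b 0 -> R[i]) (z : R[i]) : R[i] :=
  let f0 := bottom_value f in
  let v := vertical_value beta a b f0 in
  if complex.Im z == 0 then f0 (complex.Re z)
  else if complex.Im z == 2^-1 then v (complex.Re z)
  else top_value beta v (complex.Re z).

Lemma vertical_minor_neq0 {R : realType} (beta : R) (a b : int) f0 x : 0 < beta ->
  minor (vertical_eq_left beta a f0 x) (vertical_eq_right beta b f0 x) != 0.
Proof.
move=> beta0; rewrite /vertical_eq_left /vertical_eq_right.
have [? ? ? ? _] := box_minors_neq0 beta (f0 (x - 2^-1)) (f0 (x + 2^-1)) beta0.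
by case: ifP => _; case: ifP.
Qed.

Lemma sat_vertical_value {R : realType} (beta : R) (a b : int) f0 x : 0 < beta ->
  sat (vertical_eq_left beta a f0 x) (vertical_value beta a b f0 x) /\
  sat (vertical_eq_right beta b f0 x) (vertical_value beta a b f0 x).
Proof.
move=> beta0; apply: sat_cramer; last exact: vertical_minor_neq0.
- rewrite /vertical_eq_left; case: ifP => _; first exact: left_eq_consistent.
  exact: east_eq_consistent.
- rewrite /vertical_eq_right; case: ifP => _; first exact: right_eq_consistent.
  exact: west_eq_consistent.
Qed.

Lemma sat_top_value {R : realType} (beta : R) v k : 0 < beta ->
  sat (north_eq_east beta (v (k + 2^-1))) (top_value beta v k) /\
  sat (north_eq_west beta (v (k - 2^-1))) (top_value beta v k).
Proof.
move=> beta0; apply: sat_cramer.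
- exact: north_eq_east_consistent.
- exact: north_eq_west_consistent.
- by have [] := box_minors_neq0 beta (v (k + 2^-1)) (v (k - 2^-1)) beta0.
Qed.

(** * Coordinates of faces and edges *)

Lemma face_edges {R : realType} (k : R) (c := k +i* 2^-1 : R[i]) :
  [/\ c + 2^-1 = (k + 2^-1) +i* 2^-1, c + 'i%C / 2 = k +i* 1,
      c - 2^-1 = (k - 2^-1) +i* 2^-1 & c - 'i%C / 2 = k +i* 0].
Proof.
have half : (2^-1 : R[i]) = 2^-1 +i* 0.
  by rewrite -(rmorph_nat (real_complex R) 2) -fmorphV.
have ihalf : ('i%C / 2 : R[i]) = 0 +i* 2^-1 by rewrite half; simpc.
by rewrite ihalf half /c; split; apply/eqP; rewrite eq_complex /=;
  apply/andP; split; apply/eqP; field.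
Qed.

Lemma massive_s_holomorphicP {R : realType} (beta : R) (a b : int)
    (h : box_edges R a b -> R[i]) :
  massive_s_holomorphic beta h <->
  forall (k : R) (E N W S : box_edges R a b), half_int_interval R a b k ->
    \val E = (k + 2^-1) +i* 2^-1 -> \val N = k +i* 1 ->
    \val W = (k - 2^-1) +i* 2^-1 -> \val S = k +i* 0 ->
    [/\ sat (north_eq_east beta (h E)) (h N), sat (north_eq_west beta (h W)) (h N),
        sat (east_eq beta (h S)) (h E) & sat (west_eq beta (h S)) (h W)].
Proof.
split=> hol.
  move=> k E N W S kab Ek Nk Wk Sk; apply/massive_relationsP.
  have [? ? ? ?] := face_edges k.
  by apply: (hol (k +i* 2^-1)); [exists k|congruence..].
move=> c E N W S [k kab <-]; have [-> -> -> ->] := face_edges k.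
by move=> *; apply/massive_relationsP/(hol k).
Qed.

(** Writing [k = m + 1/2], the bounds give [a < m + 1] and [m < b], which integrality sharpens to
    [a <= m] and [m + 1 <= b]. *)
Lemma half_int_bounds {R : realType} (a b : int) (k : R) : half_int_interval R a b k ->
  [/\ k - 2^-1 \is a Num.int, a%:~R <= k - 2^-1 & k + 2^-1 <= b%:~R].
Proof.
move=> [/[dup] kint /intrP[m km] /andP[ak kb]].
have kE : k = m%:~R + 2^-1 by rewrite -km subrK.
have am : (a <= m)%R by rewrite -ltzD1 -(ltr_int R) intrD; lra.
have mb : (m + 1 <= b)%R by rewrite lezD1 -(ltr_int R); lra.
by move: am mb; rewrite -!(ler_int R) intrD => am mb; split=> //; lra.
Qed.

Lemma int_interval_half {R : realType} (a b : int) (k : R) : half_int_interval R a b k ->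
  int_interval R a b (k - 2^-1) /\ int_interval R a b (k + 2^-1).
Proof.
move=> /half_int_bounds[kint ak kb]; split; split.
- exact: kint.
- by apply/andP; split; lra.
- have -> : k + 2^-1 = k - 2^-1 + 1 by field.
  by rewrite rpredD // rpred1.
- by apply/andP; split; lra.
Qed.

(** An integer abscissa other than [a] is at least [a + 1], so the face on its left belongs to the
    box. *)
Lemma half_int_interval_left {R : realType} (a b : int) (x : R) :
  int_interval R a b x -> x != a%:~R -> half_int_interval R a b (x - 2^-1).
Proof.
move=> [/[dup] xint /intrP[m xm] /andP[ax xb]] xa.
have : (a + 1 <= m)%R by rewrite lezD1 -(ltr_int R) lt_neqAle -xm eq_sym xa.
rewrite -(ler_int R) intrD => am; split; last by apply/andP; split; lra.
have -> : x - 2^-1 - 2^-1 = x - 1 by field.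
by rewrite rpredB // rpred1.
Qed.

Lemma half_int_interval_right {R : realType} (a b : int) (x : R) :
  int_interval R a b x -> x != b%:~R -> half_int_interval R a b (x + 2^-1).
Proof.
move=> [/[dup] xint /intrP[m xm] /andP[ax xb]] xa.
have : (m + 1 <= b)%R by rewrite lezD1 -(ltr_int R) lt_neqAle -xm xa.
rewrite -(ler_int R) intrD => am; split; last by apply/andP; split; lra.
by rewrite addrK.
Qed.

(** * Existence and uniqueness *)

Lemma box_value_solution {R : realType} (beta : R) (a b : int)
    (f : horizontal_edges R a b 0 -> R[i]) (h : box_edges R a b -> R[i]) :
  (a < b)%R -> 0 < beta -> (forall e, h e = box_value beta f (\val e)) ->
  [/\ extends f h, massive_s_holomorphic beta h & riemann_boundary_values h].
Proof.
move=> ab beta0 hE; split.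
- move=> z w wz; rewrite hE wz.
  have [k _ zk] := set_valP z.
  by rewrite -(bottom_valueE f z k) // -[\val z]zk /box_value /= eqxx.
- apply/massive_s_holomorphicP => k E N W S [_ /andP[ak kb]] Ek Nk Wk Sk.
  have half0 : 2^-1 != 0 :> R by rewrite invr_eq0 pnatr_eq0.
  have one_half : 1 != 2^-1 :> R by apply/eqP; lra.
  rewrite !hE Ek Nk Wk Sk /box_value /= !eqxx (negbTE half0) oner_eq0 (negbTE one_half).
  have [satE satW] := sat_top_value beta (vertical_value beta a b (bottom_value f)) k beta0.
  split=> //.
  (* As [k + 1/2 > a], the left equation of the east edge is the relation of this face and not the
     boundary condition; likewise for the west edge, as [k - 1/2 < b]. *)
  + have [+ _] := sat_vertical_value beta a b (bottom_value f) (k + 2^-1) beta0.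
    by rewrite /vertical_eq_left addrK ifF //; apply/negP => /eqP; lra.
  + have [_ +] := sat_vertical_value beta a b (bottom_value f) (k - 2^-1) beta0.
    by rewrite /vertical_eq_right subrK ifF //; apply/negP => /eqP; lra.
- have half0 : 2^-1 != 0 :> R by rewrite invr_eq0 pnatr_eq0.
  move=> z [] zE; rewrite hE zE /box_value /= eqxx (negbTE half0).
  + apply/(real_multiple_left a)/sat_left_eq.
    have [+ _] := sat_vertical_value beta a b (bottom_value f) a%:~R beta0.
    by rewrite /vertical_eq_left eqxx.
  + apply/real_multiple_right/sat_right_eq => //.
    have [_ +] := sat_vertical_value beta a b (bottom_value f) b%:~R beta0.
    by rewrite /vertical_eq_right eqxx.
Qed.

(** Any solution satisfies the very pairs of equations that define [box_value], so [sat_cramer_eq]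
    identifies its values row by row: bottom, vertical, then top. *)
Lemma solution_box_value {R : realType} (beta : R) (a b : int)
    (f : horizontal_edges R a b 0 -> R[i]) (h : box_edges R a b -> R[i]) :
  (a < b)%R -> 0 < beta ->
  [/\ extends f h, massive_s_holomorphic beta h & riemann_boundary_values h] ->
  forall e, h e = box_value beta f (\val e).
Proof.
move=> ab beta0 [fh /massive_s_holomorphicP hol bv].
have half0 : 2^-1 != 0 :> R by rewrite invr_eq0 pnatr_eq0.
have one_half : 1 != 2^-1 :> R by apply/eqP; lra.
have face k : half_int_interval R a b k -> exists E N W S : box_edges R a b,
    [/\ \val E = (k + 2^-1) +i* 2^-1, \val N = k +i* 1,
        \val W = (k - 2^-1) +i* 2^-1 & \val S = k +i* 0].
  move=> kab; have : box_faces R a b (k +i* 2^-1) by exists k.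
  move=> /box_faceP; have [-> -> -> ->] := face_edges k; move=> [E N W S].
  by exists (edge E), (edge N), (edge W), (edge S).
have hS (S : box_edges R a b) k : half_int_interval R a b k ->
    \val S = k +i* 0 -> h S = bottom_value f k.
  move=> kab Sk.
  have zP : horizontal_edges R a b 0 (k +i* 0) by exists k.
  rewrite (bottom_valueE f (edge zP)) //.
  exact: fh.
have hV (e : box_edges R a b) x : int_interval R a b x -> \val e = x +i* 2^-1 ->
    h e = vertical_value beta a b (bottom_value f) x.
  move=> xab ex.
  apply: sat_cramer_eq; first exact: vertical_minor_neq0.
  - rewrite /vertical_eq_left; case: eqP => [xa|/eqP xa].
      apply/sat_left_eq/(real_multiple_left a); rewrite -xa -ex.
      by apply: bv; left; rewrite -xa.
    have kab : half_int_interval R a b (x - 2^-1) by exact: half_int_interval_left.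
    have [E [N [W [S [Ek Nk Wk Sk]]]]] := face _ kab.
    (* The edge [e] is the east edge of the face centred at abscissa [x - 1/2], and that face
       supplies the equation. *)
    rewrite -(hS S) // (_ : e = E); first by have [] := hol _ E N W S kab Ek Nk Wk Sk.
    by apply: val_inj; rewrite [LHS]ex Ek subrK.
  - rewrite /vertical_eq_right; case: eqP => [xa|/eqP xa].
      apply/sat_right_eq/(real_multiple_right _ ab); rewrite -xa -ex.
      by apply: bv; right; rewrite -xa.
    have kab : half_int_interval R a b (x + 2^-1) by exact: half_int_interval_right.
    have [E [N [W [S [Ek Nk Wk Sk]]]]] := face _ kab.
    rewrite -(hS S) // (_ : e = W); first by have [] := hol _ E N W S kab Ek Nk Wk Sk.
    by apply: val_inj; rewrite [LHS]ex Wk addrK.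
move=> e; have := set_valP e; move=> [[[k kab ek]|[x xab ex]]|[k kab ek]].
- by rewrite (hS e k) // /box_value -[\val e]ek /= eqxx.
- by rewrite (hV e x) // /box_value -[\val e]ex /= eqxx (negbTE half0).
- rewrite /box_value -[\val e]ek /= oner_eq0 (negbTE one_half).
  have [E [N [W [S [Ek Nk Wk Sk]]]]] := face _ kab.
  have [_ _ _ _ D0] := box_minors_neq0 beta (h E) (h W) beta0.
  have [] := hol _ E N W S kab Ek Nk Wk Sk.
  have -> : N = e by apply: val_inj; rewrite [RHS](esym ek).
  (* Replacing the computed vertical values by [h E] and [h W] turns the system behind [top_value]
     into the two north equations satisfied by [h]. *)
  rewrite /top_value -(hV E (k + 2^-1)) // -?(hV W (k - 2^-1)) //.
  + by move=> ? ? _ _; exact: sat_cramer_eq.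
  + by have [] := int_interval_half a b k kab.
  + by have [] := int_interval_half a b k kab.
Qed.

Theorem lemma4 (R : realType) (a b : int) (beta : R)
    (f : horizontal_edges R a b 0 -> R[i]) :
  (a < b)%R -> 0 < beta ->
  exists! h : box_edges R a b -> R[i],
    [/\ extends f h, massive_s_holomorphic beta h & riemann_boundary_values h].
Proof.
move=> ab beta0; exists (fun e => box_value beta f (\val e)); split.
  exact: box_value_solution.
move=> h solh; apply/funext => e; exact/esym/solution_box_value.
Qed.
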